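(* Let $X$ be a Banach space, $T:X\to X$ a bounded linear operator and $\varepsilon\in(0,1)$. Then every $\varepsilon$-hypercyclic vector for $T$ is a convex-cyclic vector for $T$.
   Context: A vector $x\in X$ is an $\varepsilon$-hypercyclic vector for $T$ if for every non-zero $y\in X$ there exists a non-negative integer $n$ such that $\|T^n x-y\|\le\varepsilon\|y\|$. A vector $x\in X$ is a convex-cyclic vector for $T$ if the convex hull of $\{T^n x : n=0,1,2,\ldots\}$ is dense in $X$. *)

(* Defs.v *)
From HB Require Import structures.
From mathcomp Require Import all_boot all_order all_algebra.
From mathcomp Require Import complex.
From mathcomp Require Import boolp classical_sets reals topology normedtype convex.

Set Implicit Arguments.
Unset Strict Implicit.
Unset Printing Implicit Defensive.

Import Order.TTheory GRing.Theory Num.Theory.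
Import numFieldNormedType.Exports.

Local Open Scope classical_set_scope.
Local Open Scope ring_scope.

(* The scalar field K is meant to be a realType R or its complexification R[i].
   In the order of R[i], a <= b means that b - a is a nonnegative real, and
   norms are nonnegative reals seen as elements of K. *)

(* In convex_set, the coefficients are taken in {i01 K}; for K = R[i] these are
   exactly the real numbers of [0, 1]. *)
Definition convex_hull (K : numDomainType) (X : lmodType K) (A : set X) :
  set X := smallest (@convex_set K X) A.

Definition iter_orbit (X : Type) (T : X -> X) (x : X) : set X :=
  range (fun n : nat => iter n T x).

Definition eps_hypercyclic_vector (K : numFieldType) (X : normedModType K)
    (eps : K) (T : X -> X) (x : X) : Prop :=
  forall y : X, y != 0 -> exists n : nat, `|iter n T x - y| <= eps * `|y|.

Definition convex_cyclic_vector (K : numFieldType) (X : normedModType K)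
    (T : X -> X) (x : X) : Prop :=
  dense (convex_hull (iter_orbit T x)).

(* Main.v *)
(* To approximate y, pick orbit points a_1, a_2, ... greedily: a_(n+1) is a point
   of the orbit eps-close to z_n + y, where z_n = n y - (a_1 + ... + a_n).
   Then |z_(n+1)| <= eps (|z_n| + |y|), so |z_n| stays below a constant C and
   the averages of the a_i are within C / n of y. When z_n + y = 0, where
   eps-hypercyclicity says nothing, a_(n+1) is chosen close to a small nonzero
   vector instead. *)

Require Import Defs.
From mathcomp Require Import all_boot all_order all_algebra.
From mathcomp Require Import complex.
From mathcomp Require Import boolp classical_sets reals topology normedtype convex.
From mathcomp Require Import interval_inference.

Import Order.TTheory GRing.Theory Num.Theory.
Import numFieldNormedType.Exports.

Local Open Scope classical_set_scope.
Local Open Scope ring_scope.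
Local Open Scope complex_scope.

Lemma convex_hull_avg (K : numDomainType) (X : lmodType K) (A : set X)
    (t : K) (a b : X) :
  0 <= t -> t <= 1 -> convex_hull A a -> convex_hull A b ->
  convex_hull A (t *: a + (1 - t) *: b).
Proof.
move=> t0 t1 ha hb C [Ccvx AC].
have := Ccvx a b (Itv01 t0 t1) (mem_set (ha C (conj Ccvx AC)))
             (mem_set (hb C (conj Ccvx AC))).
by move/set_mem.
Qed.

(** The vector [n.+1%:R *: (y - s)] is the residual z_(n+1) of the greedy scheme; its bound by [C]
    is what lets [step] be applied again. *)
Lemma bounded_residual_average (K : numFieldType) (X : normedModType K)
    (A : set X) (y : X) (C : K) :
  0 <= C ->
  (forall z : X, `|z| <= C -> exists2 a, A a & `|a - (z + y)| <= C) ->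
  forall n, exists2 s, convex_hull A s & `|n.+1%:R *: (y - s)| <= C.
Proof.
move=> C0 step; elim=> [|n [s hs ns]].
  have [|a Aa na] := step 0; first by rewrite normr0.
  exists a; first exact: sub_gen_smallest.
  by rewrite scale1r distrC; rewrite add0r in na.
have [a Aa na] := step _ ns.
have n2 : n.+2%:R != 0 :> K by rewrite pnatr_eq0.
(* Weight 1/(n+2) on [a] turns an average of n+1 points into one of n+2 points. *)
exists (n.+2%:R^-1 *: a + (1 - n.+2%:R^-1) *: s).
  apply: convex_hull_avg => //.
    by rewrite invf_le1 ?ler1n ?ltr0n.
  exact: sub_gen_smallest.
rewrite scalerBr scalerDr !scalerA divff// mulrBr divff// mulr1 scale1r.
rewrite -[X in X%:R - 1]addn1 natrD addrK -normrN.
(* The new residual is the opposite of the error already bounded by [step]. *)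
suff -> : - (n.+2%:R *: y - (a + n.+1%:R *: s)) = a - (n.+1%:R *: (y - s) + y) by [].
rewrite opprB scalerBr -[n.+2]addn1 natrD scalerDl scale1r.
by rewrite -addrA [X in _ = a - X]addrAC opprB.
Qed.

Lemma eps_hypercyclic_near (K : numFieldType) (X : normedModType K) (eps C : K)
    (T : X -> X) (x v w : X) :
  0 < eps -> v != 0 -> 0 < C -> eps * `|w| <= C ->
  eps_hypercyclic_vector eps T x ->
  exists2 a, iter_orbit T x a & `|a - w| <= C.
Proof.
move=> e0 v0 C0 wC hx; have [w0|w0] := eqVneq w 0; last first.
  have [n hn] := hx w w0.
  by exists (iter n T x); [exists n | exact: le_trans hn wC].
have e1 : 0 < 1 + eps by rewrite addr_gt0.
have nv : 0 < `|v| by rewrite normr_gt0.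
(* An orbit point eps-close to [c *: v] has norm at most 1 + eps times that of [c *: v]; this [c]
   makes the product equal to [C]. *)
pose c := C / (1 + eps) / `|v|.
have c0 : 0 < c by rewrite !divr_gt0.
have ncv : `|c *: v| = C / (1 + eps).
  by rewrite normrZ gtr0_norm// mulfVK// gt_eqF.
have [|n hn] := hx (c *: v); first by rewrite scaler_eq0 negb_or gt_eqF.
exists (iter n T x); first by exists n.
rewrite w0 subr0 -[iter n T x](subrK (c *: v)).
rewrite (le_trans (ler_normD _ _))// (le_trans (lerD hn (lexx _)))//.
by rewrite ncv -{2}[C / _]mul1r -mulrDl [eps + 1]addrC mulrC mulfVK// gt_eqF.
Qed.

(** The Archimedean hypothesis lets one proof serve R and R[i]; it asks [0 <= a] because in R[i]
    only reals compare with naturals. *)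
Lemma eps_hypercyclic_convex_cyclic (K : numFieldType) (X : normedModType K)
    (eps : K) (T : X -> X) (x : X) :
  (forall a : K, 0 <= a -> exists n : nat, a < n%:R) ->
  0 < eps -> eps < 1 ->
  eps_hypercyclic_vector eps T x -> convex_cyclic_vector T x.
Proof.
move=> archi e0 e1 hx O [y Oy] Oop.
(* A nonzero [v] serves to approximate 0; if there is none, X = {0} and [x] itself lies in [O]. *)
have [[v v0]|Xtriv] := pselect (exists v : X, v != 0); last first.
  have triv (z : X) : z = 0.
    by apply: contrapT => /eqP z0; apply: Xtriv; exists z.
  exists x; split; first by rewrite (triv x) -(triv y).
  by apply: sub_gen_smallest; exists 0%N.
have de : 0 < 1 - eps by rewrite subr_gt0.
(* [C] solves [eps * (C + `|y|) + 1 = C]; the [1] keeps it positive at [y = 0]. *)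
pose C := (eps * `|y| + 1) / (1 - eps).
have C0 : 0 < C by rewrite divr_gt0// ltr_wpDl// mulr_ge0// ltW.
have CE : eps * (C + `|y|) <= C.
  rewrite mulrDr -lerBrDl -[X in X - _]mul1r -mulrBl [_ * C]mulrC mulfVK ?gt_eqF//.
  by rewrite lerDl ler01.
have near_orbit z : `|z| <= C ->
    exists2 a, iter_orbit T x a & `|a - (z + y)| <= C.
  move=> zC; apply: (@eps_hypercyclic_near _ _ eps C T x v) => //.
  apply: le_trans CE; rewrite ler_pM2l//.
  by rewrite (le_trans (ler_normD _ _))// lerD2r.
have /nbhs_normP[e /= e_gt0 eO] : nbhs y O by exact: open_nbhs_nbhs.
have [n Cn] := archi (C / e) (ltW (divr_gt0 C0 e_gt0)).
have [s hs ns] := @bounded_residual_average _ _ _ _ _ (ltW C0) near_orbit n.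
exists s; split => //; apply: eO => /=.
have n0 : 0 < n.+1%:R :> K by rewrite ltr0n.
rewrite -(ltr_pM2l n0) -[X in X * `|_|]gtr0_norm// -normrZ.
rewrite (le_lt_trans ns)// -ltr_pdivrMr// (lt_le_trans Cn)// ler_nat.
exact: leqnSn.
Qed.

(* Banach spaces over the reals (first part) and over the complex numbers
   (second part). *)
Theorem theorem5p1 (R : realType) (eps : R) (heps0 : 0 < eps) (heps1 : eps < 1) :
  (forall (X : completeNormedModType R) (T : {linear X -> X}),
     bounded_near T (nbhs (0 : X)) ->
     forall x : X, eps_hypercyclic_vector eps T x -> convex_cyclic_vector T x) /\
  (forall (X : completeNormedModType R[i]) (T : {linear X -> X}),
     bounded_near T (nbhs (0 : X)) ->
     forall x : X,
       eps_hypercyclic_vector eps%:C T x -> convex_cyclic_vector T x).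
Proof.
have archiR (a : R) : 0 <= a -> exists n : nat, a < n%:R.
  by move=> a0; exists (Num.bound a); rewrite archi_boundP.
split=> X T _ x; first exact: eps_hypercyclic_convex_cyclic.
apply: eps_hypercyclic_convex_cyclic; rewrite ?ltcR//.
(* A nonnegative complex number has zero imaginary part, so the bound comes from R. *)
move=> [a b]; rewrite lecE /= => /andP[/eqP-> /archiR[n an]].
by exists n; rewrite -[n%:R](rmorph_nat (real_complex R)) ltcR.
Qed.
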